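(* The deformation $y_F$ is a stable equilibrium of the local QC energy $\mathcal{E}_{\rm qcl}$ if and only if $A_F>0$, where $A_F=\phi''(F)+4\phi''(2F)$.
   Context: Fix $N\in\mathbb{N}$ and set $\varepsilon=1/N$. The interaction potential $\phi$ satisfies: (i) $\phi\in C^4((0,\infty);\mathbb{R})$; (ii) there is $r_*>0$ such that $\phi$ is convex in $(0,r_* )$ and concave in $(r_*,\infty)$; (iii) $\phi^{(k)}(r)\to0$ rapidly as $r\to\infty$ for $k=0,\dots,4$. Throughout, $F>0$ with $F\ge r_*/2$ (so $\phi''(2F)\le0$). For a sequence $v=(v_\ell)_{\ell\in\mathbb{Z}}$ write $v_\ell'=\varepsilon^{-1}(v_\ell-v_{\ell-1})$. Let $\mathcal{U}$ be the space of real sequences $u=(u_\ell)_{\ell\in\mathbb{Z}}$ with $u_{\ell+2N}=u_\ell$ for all $\ell$ and $\sum_{\ell=-N+1}^N u_\ell=0$. Let $y_F=(F\ell\varepsilon)_{\ell\in\mathbb{Z}}$ and $\mathcal{Y}_F=\{y_F+u:u\in\mathcal{U}\}$. The local quasicontinuum (QCL) energy of $y\in\mathcal{Y}_F$ (finite when all $y_\ell'>0$) is $$\mathcal{E}_{\rm qcl}(y)=\varepsilon\sum_{\ell=-N+1}^N\big(\phi(y_\ell')+\phi(2y_\ell')\big).$$ Stable equilibrium: for $\mathcal{E}:\mathcal{Y}_F\to\mathbb{R}\cup\{+\infty\}$, $y\in\mathcal{Y}_F$ is a stable equilibrium of $\mathcal{E}$ if $\mathcal{E}$ is twice differentiable at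 $y$, the first variation satisfies $\mathcal{E}'(y)[u]=0$ for all $u\in\mathcal{U}$, and the second variation satisfies $\mathcal{E}''(y)[u,u]>0$ for all $u\in\mathcal{U}\setminus\{0\}$. *)

(* Defs.v *)
From HB Require Import structures.
From mathcomp Require Import all_boot all_order all_algebra.
From mathcomp Require Import all_classical all_reals all_analysis.
From mathcomp Require Import zify ring lra.

Set Implicit Arguments.
Unset Strict Implicit.
Unset Printing Implicit Defensive.

Import Order.TTheory GRing.Theory Num.Theory.
Import numFieldNormedType.Exports.

Local Open Scope ring_scope.
Local Open Scope classical_set_scope.

Section Potential.
Context {R : realType}.

(* Only the values of [phi] on (0, +oo) matter: for x > 0, [phi^`(k) x] depends
   on [phi] near x only. *)
Definition C4_pos (phi : R -> R) : Prop :=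
  (forall (k : nat) (x : R), (k < 4)%N -> 0 < x -> derivable (phi^`(k)) x 1) /\
  (forall x : R, 0 < x -> {for x, continuous (phi^`(4))}).

(* "Rapid" decay at infinity is only required in the weak form of convergence to
   0: no rate is prescribed. *)
Definition interaction_potential (phi : R -> R) (rstar : R) : Prop :=
  [/\ C4_pos phi,
      0 < rstar,
      convex_function `]0, rstar[ phi,
      convex_function `]rstar, +oo[ (fun r => - phi r) &
      forall k : nat, (k <= 4)%N -> phi^`(k) r @[r --> +oo] --> (0 : R)].

Definition potential_ext (phi : R -> R) (r : R) : \bar R :=
  if 0 < r then (phi r)%:E else +oo%E.

End Potential.

Section Sequences.
Context {R : realType}.
Implicit Types (N : nat) (F : R) (v y u : int -> R) (l : int).

Definition spacing N : R := N%:R^-1.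

Definition bdiff N v l : R := (spacing N)^-1 * (v l - v (l - 1)).

(* [site N] enumerates the integers -N+1, ..., N. *)
Definition site N (i : 'I_(2 * N)) : int := i%:Z - N%:Z + 1.

Definition displacements N : set (int -> R) :=
  [set u | (forall l, u (l + (2 * N)%N%:Z) = u l) /\
           \sum_(i < 2 * N) u (site i) = 0].

Definition displacements_pred N : {pred int -> R} := mem (displacements N).

Definition yF N F : int -> R := fun l => F * l%:~R * spacing N.

Definition deformations N F : set (int -> R) :=
  [set yF N F + u | u in displacements N].

Definition E_qcl (phi : R -> R) N y : \bar R :=
  ((spacing N)%:E *
   \sum_(i < 2 * N) (potential_ext phi (bdiff N y (site i)) +
                     potential_ext phi (2 * bdiff N y (site i))))%E.

End Sequences.

(* The space of displacements as a normed module, with the maximum norm over one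
   period. As this space is finite-dimensional, the choice of the norm does not
   affect differentiability. The hypothesis [0 < N] is needed for the norm to be
   definite. *)
Record disp (R : realType) (N : nat) (N_gt0 : (0 < N)%N) := Disp {
  disp_val :> int -> R ;
  _ : disp_val \in displacements_pred N }.

Section DispNormed.
Context {R : realType} {N : nat} (N_gt0 : (0 < N)%N).
Local Notation U := (disp R N_gt0).

HB.instance Definition _ := [isSub for @disp_val R N N_gt0].
HB.instance Definition _ := [Choice of U by <:].

Lemma displacements_submod : submod_closed (@displacements_pred R N).
Proof.
split=> [|a u v]; first by rewrite inE; split=> //; rewrite big1.
rewrite !inE => -[pu su] [pv sv]; split=> [l|].
  by rewrite [LHS]/(a * u _ + v _) pu pv.
rewrite (eq_bigr (fun i => a * u (site i) + v (site i)))//.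
by rewrite big_split/= -mulr_sumr su sv mulr0 addr0.
Qed.

HB.instance Definition _ := GRing.isSubmodClosed.Build R (int -> R)
  (@displacements_pred R N) displacements_submod.
HB.instance Definition _ := [SubChoice_isSubLmodule of U by <:].

Definition disp_norm (u : U) : R := \big[Num.max/0]_(i < 2 * N) `|u (site i)|.

Lemma disp_norm_ge0 (u : U) : 0 <= disp_norm u.
Proof. exact: bigmax_ge_id. Qed.

Lemma disp_norm_ub (u : U) (i : 'I_(2 * N)) : `|u (site i)| <= disp_norm u.
Proof. exact: (le_bigmax_cond _ (fun i => `|u (site i)|)). Qed.

Lemma disp_normD (u v : U) : disp_norm (u + v) <= disp_norm u + disp_norm v.
Proof.
apply: bigmax_le => [|i _]; first by rewrite addr_ge0 ?disp_norm_ge0.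
rewrite [X in `|X|]/(u (site i) + v (site i)).
by rewrite (le_trans (ler_normD _ _))// lerD// disp_norm_ub.
Qed.

Lemma disp_normZ (a : R) (u : U) : disp_norm (a *: u) = `|a| * disp_norm u.
Proof.
rewrite /disp_norm.
rewrite (big_morph _ (fun x y => maxr_pMr x y (normr_ge0 a)) (mulr0 _)).
by apply: eq_bigr => i _; rewrite -normrM.
Qed.

Lemma disp_periodic (u : U) (k l : int) : u (l + k * (2 * N)%N%:Z) = u l.
Proof.
have [pu _] : displacements N u by case: u => u /= /set_mem.
have puN (m : nat) l' : u (l' + m%:Z * (2 * N)%N%:Z) = u l'.
  elim: m l' => [|m IH] l'; first by rewrite mul0r addr0.
  by rewrite -[in RHS]IH -[in RHS]pu; congr (u _); rewrite -addn1 PoszD; ring.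
case: k => m; first exact: puN.
by rewrite -[LHS](puN m.+1); congr (u _); rewrite NegzE; ring.
Qed.

Lemma site_mod (l : int) : exists i : 'I_(2 * N), exists k : int,
  l = site i + k * (2 * N)%N%:Z.
Proof.
have N2 : (2 * N)%N%:Z != 0 by lia.
set m := l + N%:Z - 1.
have m0 := modz_ge0 m N2; have := ltz_mod m N2.
have lt_m : (`|(m %% (2 * N)%N%:Z)%Z| < 2 * N)%N.
  by have := ltz_mod m N2; lia.
exists (Ordinal lt_m), (m %/ (2 * N)%N%:Z)%Z.
rewrite /site /= gez0_abs//.
by have := divz_eq m (2 * N)%N%:Z; rewrite /m; lia.
Qed.

Lemma disp_norm0_eq0 (u : U) : disp_norm u = 0 -> u = 0.
Proof.
move=> u0; apply/val_inj/funext => l /=.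
have [i [k ->]] := site_mod l; rewrite disp_periodic.
apply/eqP; rewrite -[_ == _]normr_le0 -u0; exact: disp_norm_ub.
Qed.

HB.instance Definition _ := @Lmodule_isNormed.Build R U disp_norm
  disp_normD disp_normZ disp_norm0_eq0.

End DispNormed.

(* [B] is the (Fréchet) derivative at [x] of [z |-> 'd f z], as a map into the
   continuous linear forms with the operator norm. *)
Definition is_second_diff (R : realType) (V : normedModType R) (f : V -> R)
    (x : V) (B : V -> V -> R) : Prop :=
  [/\ forall u, scalar (B u),
      forall v, scalar (B^~ v),
      exists C : R, forall u v, `|B u v| <= C * `|u| * `|v| &
      forall e : R, 0 < e -> \forall h \near (0 : V), forall v : V,
        `|'d f (x + h) v - 'd f x v - B h v| <= e * `|h| * `|v| ].

(* Derivatives of [E] on the affine space [deformations N F] are those of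
   [u |-> E (y + u)] at 0 on the space of displacements. [fine] is harmless as
   [E] is required to be finite around [y]. *)
Definition stable_equilibrium (R : realType) (N : nat) (N_gt0 : (0 < N)%N)
    (F : R) (E : (int -> R) -> \bar R) (y : int -> R) : Prop :=
  let f := fun u : disp R N_gt0 => fine (E (y + disp_val u)) in
  [/\ deformations N F y,
      \forall u \near (0 : disp R N_gt0), E (y + disp_val u) \is a fin_num,
      \forall u \near (0 : disp R N_gt0), differentiable f u &
      exists B : disp R N_gt0 -> disp R N_gt0 -> R,
        [/\ is_second_diff f 0 B,
            forall u : disp R N_gt0, 'd f (0 : disp R N_gt0) u = 0 &
            forall u : disp R N_gt0, u != 0 -> 0 < B u u ] ].

Definition A_coef (R : realType) (phi : R -> R) (F : R) : R :=
  derive1n 2 phi F + 4 * derive1n 2 phi (2 * F).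

(* Main.v *)
Require Import Defs.
From HB Require Import structures.
From mathcomp Require Import all_boot all_order all_algebra.
From mathcomp Require Import all_classical all_reals all_analysis.
From mathcomp Require Import zify ring lra.

Import Order.TTheory GRing.Theory Num.Theory.
Import numFieldNormedType.Exports.

Local Open Scope ring_scope.
Local Open Scope classical_set_scope.

(** The local energy couples the cells only through the periodicity constraint:
    with the strains [D_i u = u'_i], which are bounded linear forms on the space
    of displacements, and [g r = phi r + phi (2 r)], it is
      [E (y_F + u) = eps * \sum_i g (F + D_i u)]
    as long as all [F + D_i u] are positive, hence for all small [u]
    ([near_positive], [E_qclE]). Since the uniform deformation has the same
    strain [F] in every cell, its first and second variations are
      [eps * g' F * \sum_i D_i u]  and
      [eps * g'' F * \sum_i D_i u * D_i v],  with [g'' F = A_coef phi F].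
    The first one vanishes because the strains of a periodic displacement
    telescope to 0 ([sum_strain]): [y_F] is always a critical point. The second
    one is [A_coef phi F] times a sum of squares, which is positive for [u != 0]
    because a displacement with zero strains is constant and has zero mean
    ([strain_eq0]). So it is positive definite if [A_coef phi F > 0]; conversely,
    testing it on one nonzero displacement, the alternating one, gives
    [A_coef phi F > 0].

    Differentiability is reduced to the scalar expansions of [g] and [g'] at a
    point, composed with the strains ([comp_forms_estimate]). Stability provides
    some second variation, which is the above one by [second_diff_unique]. *)

(** * Differentials from first-order estimates *)

Section Calculus.
Context {R : realType}.

Lemma bounded_linear_continuous_le {V W : normedModType R} (L : {linear V -> W})
    (K : R) : (forall v, `|L v| <= K * `|v|) -> continuous L.
Proof.
move=> LK; apply/bounded_linear_continuous/linear_boundedP.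
exists K; split; first exact: num_real.
by move=> r Kr v; rewrite (le_trans (LK v))// ler_wpM2r// ltW.
Qed.

(** Fréchet differentiability with an explicit candidate for the differential,
    which is only known to be linear as a plain function. *)
Lemma is_diff_of_estimate {V W : normedModType R} (f L : V -> W) (x : V) (K : R) :
  linear L -> (forall v, `|L v| <= K * `|v|) ->
  (forall e, 0 < e -> \forall h \near 0, `|f (x + h) - f x - L h| <= e * `|h|) ->
  is_diff x f L.
Proof.
move=> linL LK fL.
pose aL := GRing.isLinear.Build _ _ _ _ L linL.
pose L' : {linear V -> W} := HB.pack L aL.
have cL : continuous L' by exact: (@bounded_linear_continuous_le V W L' K).
have exp : f \o shift x = cst (f x) + L' +o_ 0 id.
  apply/eqaddoP => e e0; have := fL e e0; apply: filterS => h.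
  by rewrite !fctE /= [h + x]addrC opprD addrA.
have dL := diff_unique cL exp.
by split=> //; apply/diff_locallyP; rewrite dL; split.
Qed.

Lemma derive_estimate (g : R -> R) (r d : R) : is_derive r 1 g d ->
  forall e, 0 < e -> \forall t \near 0, `|g (r + t) - g r - d * t| <= e * `|t|.
Proof.
move=> [/derivable_nbhs + <-] e e0 => /eqaddoP/(_ e e0).
apply: filterS => t; rewrite !fctE/= /shift /= /GRing.scale/= mulr1.
by rewrite [t + r]addrC [t * _]mulrC opprD addrA.
Qed.

(** The chain rule for [g] composed with bounded linear forms, kept as an estimate
    uniform in the form: it serves both for the differential of a sum of such
    compositions and, weighted by the forms again, for its second differential. *)
Lemma comp_forms_estimate {V : normedModType R} {I : finType}
    (D : I -> V -> R) (K : R) (g : R -> R) (r d : I -> R) :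
  (forall i v, `|D i v| <= K * `|v|) ->
  (forall i, is_derive (r i) 1 g (d i)) ->
  forall e, 0 < e -> \forall h \near 0, forall i,
    `|g (r i + D i h) - g (r i) - d i * D i h| <= e * `|h|.
Proof.
move=> DK gd e e0; apply: filter_forall => i.
(* [K] itself may fail to be positive, and [e] is divided by the bound. *)
have K1 : 0 < `|K| + 1 by rewrite ltr_wpDl.
have DK1 v : `|D i v| <= (`|K| + 1) * `|v|.
  by rewrite (le_trans (DK i v))// ler_wpM2r// (le_trans (ler_norm K))// lerDl.
have /nbhs_normP[/= t0 t00 gt] := derive_estimate _ _ _ (gd i) _ (divr_gt0 e0 K1).
have := @nbhs0_lt R V _ (divr_gt0 t00 K1); apply: filterS => h hlt.
apply: (@le_trans _ _ (e / (`|K| + 1) * `|D i h|)).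
  apply: gt => /=; rewrite sub0r normrN (le_lt_trans (DK1 h))//.
  by rewrite mulrC -ltr_pdivlMr.
by rewrite -mulrA ler_pM2l// mulrC ler_pdivrMr// mulrC.
Qed.

(** Two candidates differ by [o(|h|)] in their first argument [h]; along
    [h = t *: u] this difference is linear in [t], so it is zero. *)
Lemma second_diff_unique {V : normedModType R} (f : V -> R) (x : V)
    (B C : V -> V -> R) :
  is_second_diff f x B -> is_second_diff f x C -> forall u v, B u v = C u v.
Proof.
move=> [_ Bl _ dB] [_ Cl _ dC] u v; apply/eqP; rewrite -subr_eq0 -normr_le0.
apply/ler_addgt0Pr => e e0; rewrite add0r.
pose k := 2 * (`|u| * `|v| + 1).
have k0 : 0 < k by rewrite mulr_gt0// ltr_wpDl// mulr_ge0.
have /nbhs_normP[/= rB rB0 nearB] := dB _ (divr_gt0 e0 k0).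
have /nbhs_normP[/= rC rC0 nearC] := dC _ (divr_gt0 e0 k0).
pose r := Num.min rB rC.
have r0 : 0 < r by rewrite lt_min rB0.
(* Small enough for [|t *: u| < r]; the added 1 covers the case [u = 0]. *)
pose t := r / (`|u| + 1) / 2.
have u1 : 0 < `|u| + 1 by rewrite ltr_wpDl.
have t0 : 0 < t by rewrite !divr_gt0.
have tu : `|0 - t *: u| < r.
  have rE : r = t * (2 * (`|u| + 1)) by rewrite /t; field; rewrite gt_eqF.
  rewrite sub0r normrN normrZ gtr0_norm// rE ltr_pM2l//.
  by have := normr_ge0 u; lra.
move: tu; rewrite lt_min => /andP[/nearB/(_ v) b /nearC/(_ v) c].
have hom (X : V -> V -> R) : (forall v, scalar (X^~ v)) -> X (t *: u) v = t * X u v.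
  move=> /(_ v) Xl.
  have X0 : X 0 v = 0.
    by have := Xl 1 0 0; rewrite /= scaler0 addr0 mul1r => X00; lra.
  by have := Xl t u 0; rewrite /= X0 !addr0.
rewrite (hom B)// in b; rewrite (hom C)// in c.
have tri : t * `|B u v - C u v| <= 2 * (e / k * (t * `|u|) * `|v|).
  rewrite -[t in X in X <= _]gtr0_norm// -normrM.
  have -> : t * (B u v - C u v) =
    ('d f (x + t *: u) v - 'd f x v - t * C u v) -
    ('d f (x + t *: u) v - 'd f x v - t * B u v) by ring.
  rewrite (le_trans (ler_normB _ _))//.
  rewrite normrZ gtr0_norm// in b c.
  by rewrite mulr_natl mulr2n lerD.
rewrite -(ler_pM2l t0) (le_trans tri)//.
have -> : 2 * (e / k * (t * `|u|) * `|v|) = t * e * ((2 * (`|u| * `|v|)) / k) by ring.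
apply: ler_piMr; first by rewrite ltW ?mulr_gt0.
rewrite ler_pdivrMr// mul1r /k.
by rewrite ler_pM2l// lerDl.
Qed.

End Calculus.

(** * Strains of periodic displacements *)

Section Strains.
Context {R : realType} {N : nat} (N_gt0 : (0 < N)%N).
Local Notation U := (disp R N_gt0).

Definition strain (i : 'I_(2 * N)) (u : U) : R := bdiff N u (site i).

Lemma strain_linear i : scalar (strain i).
Proof.
move=> a u v; rewrite /strain /bdiff.
have E l : (a *: u + v : U) l = a * u l + v l by [].
by rewrite !E; ring.
Qed.

Lemma disp_le_norm (u : U) (l : int) : `|u l| <= `|u|.
Proof.
by have [i [k ->]] := site_mod N_gt0 l; rewrite disp_periodic; exact: disp_norm_ub.
Qed.

Lemma strain_le i u : `|strain i u| <= 2 * N%:R * `|u|.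
Proof.
rewrite /strain /bdiff /spacing invrK normrM ger0_norm// -mulrA mulrCA ler_pM2l ?ltr0n//.
by rewrite (le_trans (ler_normB _ _))// mulr_natl mulr2n lerD// disp_le_norm.
Qed.

Lemma bdiff_yF F (u : U) i : bdiff N (yF N F + u) (site i) = F + strain i u.
Proof.
rewrite /strain /bdiff /yF /spacing /= !fctE invrK rmorphB /=.
by field; rewrite pnatr_eq0 -lt0n.
Qed.

Lemma siteE (i : 'I_(2 * N)) : site i = i.+1%:Z - N%:Z.
Proof. by rewrite /site; lia. Qed.

Lemma site_pred (i : 'I_(2 * N)) : site i - 1 = i%:Z - N%:Z.
Proof. by rewrite /site; lia. Qed.

Lemma sum_strain (u : U) : \sum_(i < 2 * N) strain i u = 0.
Proof.
(* [w] lists [u] over one closed period, from site [-N] to site [N]. *)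
pose w (k : nat) := u (k%:Z - N%:Z).
have -> : \sum_(i < 2 * N) strain i u =
    (spacing N)^-1 * \sum_(0 <= i < 2 * N) (w i.+1 - w i).
  rewrite mulr_sumr big_mkord; apply: eq_bigr => i _.
  by rewrite /strain /bdiff site_pred siteE.
rewrite telescope_sumr// /w.
have -> : (2 * N)%N%:Z - N%:Z = (0%N%:Z - N%:Z) + 1 * (2 * N)%N%:Z by lia.
by rewrite disp_periodic subrr mulr0.
Qed.

Lemma strain_eq0 (u : U) : (forall i, strain i u = 0) -> u = 0.
Proof.
move=> u'0.
have Nn0 : (N%:R : R) != 0 by rewrite pnatr_eq0 -lt0n.
pose w (k : nat) := u (k%:Z - N%:Z).
have wS (i : 'I_(2 * N)) : w i.+1 = w i.
  have := u'0 i; rewrite /strain /bdiff site_pred siteE /spacing invrK.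
  by move/eqP; rewrite mulf_eq0 (negPf Nn0) subr_eq0 => /eqP.
have wsite (i : 'I_(2 * N)) : u (site i) = w i.+1 by rewrite siteE.
have w0 k : (k <= 2 * N)%N -> w k = w 0%N.
  by elim: k => [//|k IH] kN; rewrite -IH ?(ltnW kN)// (wS (Ordinal kN)).
have [_ su] : displacements N u by case: u {u'0 w wS wsite w0} => u /= /set_mem.
have u0 : w 0%N = 0.
  move: su; rewrite (eq_bigr (fun=> w 0%N)); last first.
    by move=> i _; rewrite wsite w0.
  rewrite sumr_const card_ord => /eqP; rewrite mulrn_eq0 => /orP[|/eqP//].
  by rewrite muln_eq0/= eqn0Ngt N_gt0.
apply/val_inj/funext => l /=; have [i [k ->]] := site_mod N_gt0 l.
by rewrite disp_periodic wsite w0.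
Qed.

(** The period [2 * N] is even, so alternating signs are periodic with zero sum:
    a nonzero displacement for every [N > 0]. *)
Lemma alternating_displacement : displacements N (fun l : int => (-1 : R) ^ l).
Proof.
have n1 : (-1 : R) != 0 by rewrite oppr_eq0 oner_eq0.
have alt n : \sum_(i < 2 * n) (-1) ^+ i = 0 :> R.
  elim: n => [|n IH]; first by rewrite muln0 big_ord0.
  by rewrite mulnS !big_ord_recr/= IH add0r exprS mulN1r subrr.
split=> [l|]; first by rewrite expfzDr// -exprnP exprM sqrrN !expr1n mulr1.
rewrite (eq_bigr (fun i : 'I_(2 * N) => (-1 : R) ^ (1 - N%:Z) * (-1) ^+ i)); last first.
  by move=> i _; rewrite exprnP -expfzDr// /site; congr (_ ^ _); lia.
rewrite -mulr_sumr; apply/eqP; rewrite mulf_eq0; apply/orP; right; apply/eqP.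
exact: alt.
Qed.

Definition alternating : U := Disp N_gt0 (mem_set alternating_displacement).

Lemma alternating_neq0 : alternating != 0.
Proof.
apply/eqP => /(congr1 (fun u : U => u 0)); rewrite /= expr0z => /eqP.
by rewrite oner_eq0.
Qed.

End Strains.

(** * The energy of one cell *)

Section CellEnergy.
Context {R : realType}.
Implicit Types phi : R -> R.

Definition cell_energy phi (r : R) : R := phi r + phi (2 * r).
Definition cell_force phi (r : R) : R := derive1 phi r + 2 * derive1 phi (2 * r).

Lemma is_derive_dilate (f : R -> R) (k r d : R) :
  is_derive (k * r) 1 f d -> is_derive r 1 (fun x => f (k * x)) (k * d).
Proof.
move=> fd; have kx : is_derive r 1 (fun x : R => k * x) k.
  by apply: is_derive_eq; rewrite /GRing.scale/= mulr1 ?addr0.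
by have := @is_derive1_comp R f (fun x => k * x) r _ _ fd kx; rewrite mulrC.
Qed.

Lemma is_derive_derive1n phi k (r : R) : C4_pos phi -> (k < 4)%N -> 0 < r ->
  is_derive r 1 (derive1n k phi) (derive1n k.+1 phi r).
Proof. by move=> [dphi _] k4 r0; split; [exact: dphi|rewrite derive1nS derive1E]. Qed.

Lemma cell_energy_derive phi (r : R) : C4_pos phi -> 0 < r ->
  is_derive r 1 (cell_energy phi) (cell_force phi r).
Proof.
move=> C4 r0; have r20 : 0 < 2 * r by rewrite mulr_gt0.
apply: is_deriveD; first exact: (is_derive_derive1n _ 0).
exact/is_derive_dilate/(is_derive_derive1n _ 0).
Qed.

Lemma cell_force_derive phi (r : R) : C4_pos phi -> 0 < r ->
  is_derive r 1 (cell_force phi) (A_coef phi r).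
Proof.
move=> C4 r0; have r20 : 0 < 2 * r by rewrite mulr_gt0.
have -> : A_coef phi r = derive1n 2 phi r + 2 * (2 * derive1n 2 phi (2 * r)).
  by rewrite /A_coef; ring.
have force2 := is_derive_dilate _ _ _ _ (is_derive_derive1n phi 1 _ C4 isT r20).
exact: (is_deriveD (is_derive_derive1n phi 1 _ C4 isT r0) (is_deriveZ 2 force2)).
Qed.

End CellEnergy.

(** * The variations of the local energy *)

Section Energy.
Context {R : realType} {N : nat} (N_gt0 : (0 < N)%N).
Context (phi : R -> R) (F : R) (C4 : C4_pos phi) (F_gt0 : 0 < F).
Local Notation U := (disp R N_gt0).
Local Notation D := (strain N_gt0).
Local Notation eps := (spacing N : R).

Let eps_gt0 : 0 < eps.
Proof. by rewrite invr_gt0 ltr0n. Qed.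

Definition energy (u : U) : R := eps * \sum_i cell_energy phi (F + D i u).

Definition energy_diff (u v : U) : R :=
  eps * \sum_i cell_force phi (F + D i u) * D i v.

Definition energy_hessian (u v : U) : R :=
  eps * \sum_i A_coef phi F * D i u * D i v.

(** The common shape of the first variations and of the remainders in their
    expansion: a weighted sum of strains is bounded by its largest weight. *)
Lemma sum_forms_le (c : 'I_(2 * N) -> R) (M : R) (v : U) :
  (forall i, `|c i| <= M) ->
  `|eps * \sum_i c i * D i v| <= 4 * N%:R * M * `|v|.
Proof.
move=> cM; rewrite normrM gtr0_norm//.
have N0 : 0 < N%:R :> R by rewrite ltr0n.
rewrite /spacing ler_pdivrMl//.
apply: (le_trans (ler_norm_sum _ _ _)).
apply: (@le_trans _ _ (\sum_(i < 2 * N) (M * (2 * N%:R * `|v|)))).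
  by apply: ler_sum => i _; rewrite normrM ler_pM// strain_le.
rewrite sumr_const card_ord -[X in X <= _]mulr_natl natrM.
by have -> : 2 * N%:R * (M * (2 * N%:R * `|v|)) = N%:R * (4 * N%:R * M * `|v|) by ring.
Qed.

(** The strains are small with the displacement, so near [y_F] no cell is
    inverted and the energy is finite. *)
Lemma near_positive : \forall u \near (0 : U), forall i, 0 < F + D i u.
Proof.
have N0 : 0 < 2 * N%:R :> R by rewrite mulr_gt0// ltr0n.
have := @nbhs0_lt R U _ (divr_gt0 F_gt0 N0); apply: filterS => u.
rewrite ltr_pdivlMr// mulrC => uF i.
have := le_lt_trans (strain_le N_gt0 i u) uF.
by rewrite ltr_norml => /andP[]; lra.
Qed.

Lemma E_qclE (u : U) : (forall i, 0 < F + D i u) ->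
  E_qcl phi N (yF N F + u) = (energy u)%:E.
Proof.
move=> Du; rewrite /E_qcl /energy EFinM; congr (_ * _)%E.
rewrite -sumEFin; apply: eq_bigr => i _.
by rewrite bdiff_yF /potential_ext Du mulr_gt0// Du.
Qed.

Lemma energy_diff_linear u : scalar (energy_diff u).
Proof.
move=> a v w; rewrite /energy_diff mulrCA [a * _]mulr_sumr -mulrDr -big_split; congr (_ * _).
by apply: eq_bigr => i _; rewrite strain_linear /=; ring.
Qed.

(** The differential is needed at all displacements near 0, not only at 0, for
    its own derivative to make sense. *)
Lemma qcl_is_diff u : (\forall w \near u, forall i, 0 < F + D i w) ->
  is_diff u (fun w : U => fine (E_qcl phi N (yF N F + w))) (energy_diff u).
Proof.
move=> nearu; have Du := nbhs_singleton nearu.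
pose M := \sum_i `|cell_force phi (F + D i u)|.
apply: (@is_diff_of_estimate _ _ _ _ _ _ (4 * N%:R * M)).
- exact: energy_diff_linear.
- move=> v; apply: sum_forms_le => i.
  by rewrite /M (bigD1 i)//= lerDl sumr_ge0.
move=> e e0.
(* The weights [eps] of the [2 * N] cells add up to 2. *)
have e2 : 0 < e / 2 by rewrite divr_gt0.
have := @comp_forms_estimate R U _ D _ (cell_energy phi) (fun i => F + D i u) _
  (strain_le N_gt0) (fun i => cell_energy_derive _ _ C4 (Du i)) _ e2.
move=> est.
have nearu0 : \forall h \near 0, forall i, 0 < F + D i (u + h).
  by move: nearu; rewrite (near_shift 0)/=; apply: filterS => h; rewrite subr0 addrC.
apply: filterS2 est nearu0 => h est Duh.
rewrite !E_qclE//= /energy /energy_diff -mulrBr -mulrBr -!sumrB normrM gtr0_norm//.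
rewrite /spacing ler_pdivrMl ?ltr0n//.
apply: (le_trans (ler_norm_sum _ _ _)).
apply: (@le_trans _ _ (\sum_(i < 2 * N) (e / 2 * `|h|))).
  apply: ler_sum => i _; rewrite (le_trans _ (est i))//.
  have -> // : D i (u + h) = D i u + D i h.
    by have := strain_linear N_gt0 i 1 u h; rewrite scale1r mul1r.
  by rewrite addrA.
rewrite sumr_const card_ord -[X in X <= _]mulr_natl natrM.
by have -> : 2 * N%:R * (e / 2 * `|h|) = N%:R * (e * `|h|) by field.
Qed.

Lemma diff_qcl u : (\forall w \near u, forall i, 0 < F + D i w) ->
  'd (fun w : U => fine (E_qcl phi N (yF N F + w))) u = energy_diff u :> (U -> R).
Proof. by move=> /qcl_is_diff []. Qed.

Lemma strain0 i : D i 0 = 0 :> R.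
Proof. by have := strain_linear N_gt0 i (1 : R) 0 0; rewrite scaler0 addr0 => ?; lra. Qed.

(** The difference of the first variations at [h] and 0, minus the Hessian, is the
    sum of the strains of the test displacement weighted by the remainders of
    [g'] at [F]; for small [h] each of them is at most [e / (4 * N)] times
    [|h|], which compensates the constant of [sum_forms_le]. *)
Lemma qcl_second_diff :
  is_second_diff (fun w : U => fine (E_qcl phi N (yF N F + w))) 0 energy_hessian.
Proof.
split.
- move=> u a v w; rewrite /energy_hessian mulrCA [a * _]mulr_sumr -mulrDr -big_split; congr (_ * _).
  by apply: eq_bigr => i _; rewrite strain_linear /=; ring.
- move=> w a u v; rewrite /= /energy_hessian mulrCA [a * _]mulr_sumr -mulrDr -big_split; congr (_ * _).
  by apply: eq_bigr => i _; rewrite strain_linear /=; ring.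
- exists (4 * N%:R * (`|A_coef phi F| * (2 * N%:R))) => u v.
  rewrite (le_trans (@sum_forms_le _ (`|A_coef phi F| * (2 * N%:R * `|u|)) v _))//.
    by move=> i; rewrite normrM ler_wpM2l// strain_le.
  by rewrite !mulrA.
move=> e e0.
have N0 : 0 < 4 * N%:R :> R by rewrite mulr_gt0// ltr0n.
have est := @comp_forms_estimate R U _ D _ (cell_force phi) (fun=> F) _
  (strain_le N_gt0) (fun i => cell_force_derive _ _ C4 F_gt0) _ (divr_gt0 e0 N0).
have npos := near_join near_positive.
apply: filterS2 est npos => h est npos v.
rewrite add0r !diff_qcl//; last exact: near_positive.
rewrite /energy_diff /energy_hessian -mulrBr -mulrBr -!sumrB.
under eq_bigr do rewrite strain0 addr0 -mulrBl -mulrBl.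
rewrite (le_trans (sum_forms_le _ _ v est))//.
by rewrite mulrA mulrCA divff ?gt_eqF// mulr1.
Qed.

Lemma energy_diff0 u : energy_diff 0 u = 0.
Proof.
rewrite /energy_diff; under eq_bigr do rewrite strain0.
by rewrite -mulr_sumr sum_strain !mulr0.
Qed.

(** An equality, as the sum of squares that multiplies [A_coef phi F] is positive:
    it gives both directions of the stability criterion. *)
Lemma hessian_diag_gt0 u : u != 0 ->
  (0 < energy_hessian u u) = (0 < A_coef phi F).
Proof.
move=> u0.
have -> : energy_hessian u u = (eps * \sum_i D i u ^+ 2) * A_coef phi F.
  rewrite /energy_hessian -mulrA mulr_suml; congr (_ * _).
  by apply: eq_bigr => i _; rewrite expr2; ring.
rewrite pmulr_rgt0// mulr_gt0// lt0r sumr_ge0 ?andbT => [|i _]; last exact: sqr_ge0.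
apply: contra_neq u0 => /eqP; rewrite psumr_eq0 => [/allP Du0|i _]; last exact: sqr_ge0.
apply: strain_eq0 => i; apply/eqP; rewrite -sqrf_eq0.
by apply: Du0; rewrite mem_index_enum.
Qed.

End Energy.

(** * Stability of the uniform deformation *)

Theorem proposition3 (R : realType) (N : nat) (N_gt0 : (0 < N)%N)
    (phi : R -> R) (rstar : R) (hphi : interaction_potential phi rstar)
    (F : R) (F_gt0 : 0 < F) (hF : rstar / 2 <= F) :
  stable_equilibrium N_gt0 F (E_qcl phi N) (yF N F) <-> 0 < A_coef phi F.
Proof.
have [C4 _ _ _ _] := hphi.
have secd := qcl_second_diff N_gt0 _ _ C4 F_gt0.
split=> [[_ _ _ [B [dB _ Bpos]]]|A0].
  have u0 := alternating_neq0 (R := R) N_gt0.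
  rewrite -(hessian_diag_gt0 _ _ _ _ u0) -(second_diff_unique _ _ _ _ dB secd).
  exact: Bpos.
split.
- exists 0; last by rewrite addr0.
  by split=> //; rewrite big1.
- by have := near_positive N_gt0 F F_gt0; apply: filterS => u /E_qclE ->.
- have := near_join (near_positive N_gt0 F F_gt0); apply: filterS => u nu.
  by have [] := qcl_is_diff N_gt0 _ _ C4 u nu.
exists (energy_hessian N_gt0 phi F); split=> //.
- by move=> u; rewrite (diff_qcl N_gt0 _ _ C4)// ?energy_diff0//; exact: near_positive.
- by move=> u u0; rewrite hessian_diag_gt0.
Qed.
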